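(* Let $\lambda$ be an infinite cardinal and let $X$ be a $T_2$ (Hausdorff) space such that $\big(2^{2^\lambda},\lambda\big)$ is a pinning down pair for $X$. Then $d(X) \le \lambda$.
   Context: For cardinals $\kappa > \lambda \ge \omega$, $(\kappa,\lambda)$ is a pinning down pair for a topological space $X$ if for every family $\mathcal{U}$ of non-empty open sets in $X$ with $|\mathcal{U}| \le \kappa$ there is $B \subset X$ with $|B| \le \lambda$ such that $B \cap U \ne \emptyset$ for each $U \in \mathcal{U}$. $d(X)$ is the density of $X$. *)

(* Defs.v *)
From mathcomp Require Import all_boot all_classical topology.

Set Implicit Arguments.
Unset Strict Implicit.
Unset Printing Implicit Defensive.

Local Open Scope classical_set_scope.
Local Open Scope card_scope.

(* A type K stands for the cardinal |K|, so that [set (set K)] stands for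
   2^(2^|K|).  The pair (|K|, |L|) is meant to satisfy |K| > |L| >= aleph_0. *)
Definition pinning_down_pair (K L : Type) (X : topologicalType) : Prop :=
  forall U : set (set X),
    (forall u, U u -> open u /\ u !=set0) ->
    U #<= [set: K] ->
    exists2 B : set X, B #<= [set: L] & forall u, U u -> B `&` u !=set0.

(* d(X) is the least cardinality of a dense subset of X; [is_density K X]
   says that |K| = d(X). *)
Definition is_density (K : Type) (X : topologicalType) : Prop :=
  (exists2 D : set X, dense D & D #= [set: K]) /\
  (forall E : set X, dense E -> [set: K] #<= E).

(* Since d(X) is only determined up to equinumerosity, d(X) <= |L| says that
   some representative of d(X) injects into L; any other one then does too. *)
Definition density_le (X : topologicalType) (L : Type) : Prop :=
  exists2 K : Type, is_density K X & [set: K] #<= [set: L].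

(* Main.v *)
(* Write K for 2^(2^|L|).  Two distinct regular open sets U, V have a nonempty
   difference U \ cl V or V \ cl U, so a set B pinning down all such differences
   within a family of at most K regular open sets separates the family by traces
   on B; hence the family has at most 2^|L| members.  As 2^|L| < K, there are at
   most 2^|L| regular open sets altogether, and in a Hausdorff space these
   separate points, so |X| <= K.  Then X has at most K^|L| = K subsets of size at
   most |L|; if none were dense, the complements of their closures would be a
   family of at most K nonempty open sets pinned down by none of them. *)

Require Import Defs.
From mathcomp Require Import all_boot all_classical topology.

Local Open Scope classical_set_scope.
Local Open Scope card_scope.

(** * Cardinal arithmetic on types and sets *)

Lemma set_inj_card_le {T U : Type} (A : set T) (f : T -> U) :
  set_inj A f -> A #<= [set: U].
Proof.
move=> fI; have /injfunPex[g] :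
  exists2 g : T -> U, set_fun A [set: U] g & set_inj A g by exists f.
exact: inj_card_le.
Qed.

Lemma card_leTP {T U : Type} :
  [set: T] #<= [set: U] <-> exists f : T -> U, injective f.
Proof.
split=> [|[f fI]]; last by apply: (@set_inj_card_le _ _ _ f) => x y _ _; apply: fI.
elim/Ppointed: U => U.
  rewrite emptyE => /eqP T0; have F (t : T) : False by have := in_setT t; rewrite T0 inE.
  by exists (fun t => False_rect _ (F t)) => t; case: (F t).
by move=> /pcard_injP[f fI]; exists f => x y; apply: fI; rewrite inE.
Qed.

Lemma card_le_set_inj {T U : Type} (u : U) (A : set T) :
  A #<= [set: U] -> exists f : T -> U, set_inj A f.
Proof.
elim/Ppointed: U => U in u *; first by have := in_setT u; rewrite emptyE inE.
by move=> /pcard_injP.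
Qed.

(* Zorn's lemma gives a maximal set of choice functions that pairwise disagree
   everywhere; the evaluation at some index is onto, since otherwise missed
   values could be collected into a further choice function. *)
Lemma card_le_min {I : Type} (T : I -> Type) (i0 : I) :
  exists i, forall j, [set: T i] #<= [set: T j].
Proof.
pose P := [set G : set (forall i, T i) |
  forall i f g, G f -> G g -> f i = g i -> f = g].
have [|G [GP Gmax]] := @Zorn_bigcup _ P.
  move=> F FP Ftot i f g [A FA Af] [B FB Bg]; case: (Ftot _ _ FA FB) => AB.
    exact: (FP _ FB i) (AB _ Af) Bg.
  exact: (FP _ FA i) Af (AB _ Bg).
have [[i iP]|/forallNP nP] := pselect (exists i, forall t, exists2 f, G f & f i = t).
  exists i => j; apply/card_leTP.
  have /choice[s sP] : forall t, exists f, G f /\ f i = t.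
    by move=> t; have [f] := iP t; exists f.
  exists (fun t => s t j) => t u /= /(GP _ _ _ (sP t).1 (sP u).1) stu.
  by rewrite -(sP t).2 -(sP u).2 stu.
have nP' i : {t : T i | forall f, G f -> f i <> t}.
  apply: cid; have /existsNP[t tP] := nP i.
  by exists t => f Gf fit; apply: tP; exists f.
pose h i := sval (nP' i).
have hP i f : G f -> f i <> h i by rewrite /h; case: (nP' i) => t /= + Gf; apply.
exfalso; apply: (Gmax (h |` G)).
  split; first by move=> f; right.
  by move=> /(_ h (or_introl erefl)) /(hP i0); apply.
move=> i f g [->|Gf] [->|Gg] //.
- by move=> /esym/(hP _ _ Gg).
- by move=> /(hP _ _ Gf).
- exact: GP.
Qed.

(** Comparability is the existence of a least cardinal in a family of two. *)
Lemma card_le_total {T U : Type} (A : set T) (B : set U) :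
  A #<= B \/ B #<= A.
Proof.
have [[] /(_ _)H] :=
  card_le_min (fun b : bool => if b then set_type A else set_type B) true.
  by left; have := H false; rewrite (card_le_eql (card_setT _)) (card_le_eqr (card_setT _)).
by right; have := H true; rewrite (card_le_eql (card_setT _)) (card_le_eqr (card_setT _)).
Qed.

Lemma Cantor_set (T : Type) : ~ ([set: set T] #<= [set: T]).
Proof.
move=> /card_leTP[f fI]; pose D := [set t | exists2 A, f A = t & ~ A t].
have nD : ~ D (f D) by move=> [A /fI -> nDD]; apply: (nDD); exists D.
by apply: (nD); exists D.
Qed.

(* A maximal disjoint family of countably infinite sets covers all of [L] up
   to a finite set, whence L <= E * nat for an index set E with E * nat <= L. *)
Lemma infinite_card_double {L : Type} :
  infinite_set [set: L] -> [set: bool * L] #<= [set: L].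
Proof.
elim/Ppointed: L => L; first by rewrite emptyE => /(_ (finite_set0 _)).
move=> Linf; apply/card_leTP.
have [E [EI Etriv Emax]] := ex_maximal_disjoint_subcollection
  (fun f : nat -> L => range f) [set f | injective f].
pose R := ~` \bigcup_(f in E) range f.
have Rfin : finite_set R.
  apply: contrapT => /infiniteP /pcard_leP/injfunPex[g gR /in2TT gI].
  have gE : ~ E g by move=> Eg; apply: (gR 0); [|exists g => //; exists 0].
  have gd f n m : E f -> f n <> g m.
    by move=> Ef fg; apply: (gR m) => //; exists f => //; exists n.
  apply: (Emax (g |` E)).
  - by split; [move=> f; right | move=> /(_ g (or_introl erefl))].
  - by move=> f [->|/EI].
  - move=> f h [->|Ef] [->|Eh] //.
    + by move=> [_ [[n _ <-] [m _ /gd]]] /(_ Eh).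
    + by move=> [_ [[n _ <-] [m _ /esym/gd]]] /(_ Ef).
    + exact: Etriv.
have [f0 Ef0] : E !=set0.
  apply: contrapT => /nonemptyPn E0; apply: Linf.
  by move: Rfin; rewrite /R E0 bigcup_set0 setC0.
have [r rI] := card_le_set_inj 0 _ (finite_set_countable Rfin).
have evI f g n m : E f -> E g -> f n = g m -> f = g /\ n = m.
  move=> Ef Eg fg; have fEg : f = g.
    by apply: Etriv => //; exists (f n); split; [exists n|exists m].
  by split=> //; subst g; apply: (EI f Ef).
(* A point [f n] with [f] in [E] gets the coordinates [(f, 2n)]. The finite remainder [R] is put at
   odd indices of the fixed sequence [f0], so the two kinds of points never collide. *)
have /choice[c cP] : forall x, exists p : (nat -> L) * nat, E p.1 /\
    if x \in R then p = (f0, (r x).*2.+1) else p.1 p.2./2 = x /\ ~~ odd p.2.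
  move=> x; have [_|] := boolP (x \in R); first by exists (f0, (r x).*2.+1).
  rewrite notin_setE /R => /contrapT[f Ef [n _ fn]].
  by exists (f, n.*2) => /=; rewrite doubleK odd_double.
have cI : injective c.
  move=> x y cxy; have [_ cx] := cP x; have [_ cy] := cP y; move: cx cy.
  rewrite cxy; case: ifPn => xR; case: ifPn => yR.
  - by move=> -> [] /double_inj /rI; apply.
  - by move=> -> /= [_]; rewrite odd_double.
  - by move=> [_ +] cE; rewrite cE /= odd_double.
  - by move=> [+ _] [+ _] => ->.
(* Doubling the index once more makes room for the tag: parity recovers the boolean, and halving
   recovers the coordinates. *)
exists (fun p : bool * L => (c p.2).1 ((c p.2).2.*2 + p.1)) => -[b x] [b' y] /=.
move=> /evI-/(_ (cP x).1 (cP y).1)[cc nn].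
have bb : b = b' by move/(congr1 odd): nn; rewrite !oddD !odd_double; case: b; case: b'.
move: nn; rewrite bb => /addIn/double_inj cc2; congr pair; apply: cI.
by case: (c x) (c y) cc cc2 => ? ? [? ?] /= -> ->.
Qed.

(** A pair [(l, A)] is coded by the subset of [bool * L] consisting of [l] tagged [false] and the
    elements of [A] tagged [true]. *)
Lemma card_le_prod_set {L : Type} :
  infinite_set [set: L] -> [set: L * set L] #<= [set: set L].
Proof.
move=> /infinite_card_double/card_leTP[d dI]; apply/card_leTP.
exists (fun p => d (false, p.1) |` [set d (true, a) | a in p.2]) => -[l A] [m B] /=.
move=> /seteqP[AB BA]; congr pair.
  by have [|/dI[]|[a _ /dI]] := AB (d (false, l)); first by left.
apply/seteqP; split=> a aA.
  by have [|/dI|[b Bb /dI[<-]]] := AB (d (true, a)); first by right; exists a.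
by have [|/dI|[b Bb /dI[<-]]] := BA (d (true, a)); first by right; exists a.
Qed.

(** This is currying: a map from [L] to subsets of [M] is a subset of [L * M]. *)
Lemma card_le_fun_set {L M : Type} :
  [set: L * M] #<= [set: M] -> [set: L -> set M] #<= [set: set M].
Proof.
move=> /card_leTP[c cI]; apply/card_leTP.
exists (fun f => [set m | exists2 p, f p.1 p.2 & m = c p]) => f g /seteqP[fg gf].
apply/funext => l; apply/seteqP; split=> m.
  by move=> fm; have [|p gp /cI pE] := fg (c (l, m)); [exists (l, m)|subst p].
by move=> gm; have [|p fp /cI pE] := gf (c (l, m)); [exists (l, m)|subst p].
Qed.

Lemma card_le_fun {T U V : Type} :
  [set: U] #<= [set: V] -> [set: T -> U] #<= [set: T -> V].
Proof.
move=> /card_leTP[f fI]; apply/card_leTP; exists (fun g => f \o g) => g h gh.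
by apply/funext => t; apply: fI; have := congr1 (@^~ t) gh.
Qed.

(** The pair is read off at two distinct indices [e 0] and [e 1]. *)
Lemma card_le_pair_fun {L T : Type} :
  infinite_set [set: L] -> [set: T * T] #<= [set: L -> T].
Proof.
move=> /infiniteP/card_leTP[e eI]; apply/card_leTP.
exists (fun p l => if `[< l = e 0 >] then p.1 else p.2) => -[a b] [a' b'] /= ab.
have := congr1 (@^~ (e 0)) ab; have := congr1 (@^~ (e 1)) ab => /=.
by rewrite asboolF ?asboolT// => [-> -> //|/eI].
Qed.

Lemma card_le_fun_pow2 {L : Type} :
  infinite_set [set: L] -> [set: L -> set (set L)] #<= [set: set (set L)].
Proof. by move=> Linf; exact/card_le_fun_set/card_le_prod_set. Qed.

(** * Consequences of the pinning down property *)

Section pinning_down.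
Context {L : Type} {X : topologicalType}.
Hypothesis Linf : infinite_set [set: L].
Hypothesis pinX : pinning_down_pair (set (set L)) L X.

Lemma pinning_down_regopen_sub (S : set (set X)) :
  S `<=` @regopen X -> S #<= [set: set (set L)] -> S #<= [set: set L].
Proof.
move=> Sreg SK.
pose F := [set W | W !=set0 /\ exists p, (S p.1 /\ S p.2) /\ W = p.1 `\` closure p.2].
have [||B BL Bpin] := pinX F.
- move=> W [W0 [[U V] /= [[SU SV] WE]]]; split=> //; rewrite WE.
  rewrite setDE; apply: openI; last exact/closed_openC/closed_closure.
  by rewrite -(Sreg _ SU); exact: open_interior.
- have /pfcard_geP[S0|/surjfunPex[f SE]] := SK.
    by rewrite (_ : F = set0) ?card_ge0// -subset0 => W [_ [p [[]]]]; rewrite S0.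
  (* Pairs of codes bound the size of [F] by K * K <= K^|L| <= K. *)
  have Fsub : F `<=` range (fun p => f p.1 `\` closure (f p.2)).
    by rewrite /F SE => W [_ [[U V] /= [[[s _ <-] [t _ <-]] ->]]]; exists (s, t).
  apply: card_le_trans (subset_card_le Fsub) _.
  apply: card_le_trans (card_image_le _ _) _.
  exact: card_le_trans (card_le_pair_fun Linf) (card_le_fun_pow2 Linf).
(* An injection [b] of [B] into [L] turns traces on [B] into subsets of [L]. *)
have [l _] := infinite_setN0 Linf; have [b bI] := card_le_set_inj l _ BL.
apply: (@set_inj_card_le _ _ _ (fun U => b @` (B `&` U))) => U V /set_mem SU /set_mem SV UV.
(* By regularity, [U'] inside the closure of [V'] gives [U'] inside [V'] on taking interiors.
   Otherwise [B] has a point in [U'] outside that closure, and the coded traces differ. *)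
have sub U' V' : S U' -> S V' -> b @` (B `&` U') = b @` (B `&` V') -> U' `<=` V'.
  move=> SU' SV' UV'; rewrite -(Sreg _ SU') -(Sreg _ SV').
  suff /closureS : U' `<=` closure V'.
    by rewrite -(closure_id (closure V')).1; [exact: interiorS | exact: closed_closure].
  apply: contrapT => /nonsubset nUV.
  have [|x [Bx [Ux nVx]]] := Bpin (U' `\` closure V'); first by split=> //; exists (U', V').
  have : (b @` (B `&` V')) (b x) by rewrite -UV'; exists x.
  move=> [y [By Vy] /bI]; rewrite !inE => /(_ By Bx) yx.
  by apply: nVx; apply: subset_closure; rewrite -yx.
by apply/seteqP; split; exact: sub.
Qed.

(** If there were more than K regular open sets, a subfamily of size exactly K would have at most
    2^|L| members, against Cantor. *)
Lemma pinning_down_card_regopen : @regopen X #<= [set: set L].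
Proof.
apply: pinning_down_regopen_sub => //.
have [//|/card_subP[S SK Sreg]] := card_le_total (@regopen X) [set: set (set L)].
exfalso; apply: (@Cantor_set (set L)).
rewrite -(card_le_eql SK); apply: pinning_down_regopen_sub => //.
by rewrite (card_le_eql SK).
Qed.

Lemma pinning_down_card : hausdorff_space X -> [set: X] #<= [set: set (set L)].
Proof.
rewrite open_hausdorff => X2.
have [r rI] := card_le_set_inj set0 _ pinning_down_card_regopen.
(* A point is coded by the regular open sets containing it. For disjoint open [A] around [x] and [B]
   around [y], the interior of the closure of [A] contains [x] but not [y]. *)
apply/card_leTP; exists (fun x => r @` [set U | regopen U /\ U x]) => x y xy.
apply: contrapT => /eqP/X2[[A B] /= [/set_mem Ax /set_mem By] [oA oB /eqP AB]].
have rA : regopen (closure A)° by exact/interior_closed_regopen/closed_closure.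
have Arx : (closure A)° x.
  by apply: (interiorS (@subset_closure _ A)); rewrite (interior_id A).1.
have : (r @` [set U | regopen U /\ U y]) (r (closure A)°) by rewrite -xy; exists (closure A)°.
move=> [U [rU Uy] /rI]; rewrite !inE => /(_ rU rA) UA.
have /interior_subset clAy : (closure A)° y by rewrite -UA.
have [|z] := clAy B; first exact: open_nbhs_nbhs.
by rewrite AB.
Qed.

Lemma pinning_down_dense : hausdorff_space X -> exists2 D : set X, dense D & D #<= [set: L].
Proof.
move=> X2; apply: contrapT => nD.
have nB (B : set X) : B #<= [set: L] -> ~` closure B !=set0.
  move=> BL; apply: contrapT => /nonemptyPn; rewrite -subset0 => cB; apply: nD.
  exists B => // O [x Ox] oO; have cBx : closure B x by apply: contrapT => /cB.
  by have [y [By Oy]] := cBx O (open_nbhs_nbhs (conj oO Ox)); exists y.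
have nr (g : L -> X) : ~` closure (range g) !=set0 by exact/nB/card_image_le.
(* Indexing by maps [L -> X] gives the bound K^|L|, and every nonempty set of size at most |L| is
   the range of such a map. *)
pose F := range (fun g : L -> X => ~` closure (range g)).
have [||B BL Bpin] := pinX F.
- move=> _ [g _ <-]; split => //.
  exact/closed_openC/closed_closure.
- apply: card_le_trans (card_image_le _ _) _.
  exact: card_le_trans (card_le_fun (pinning_down_card X2)) (card_le_fun_pow2 Linf).
(* The empty set is no such range; it already fails to meet the member of [F] given by a constant
   map. *)
have /pfcard_geP[B0|/surjfunPex[g Bg]] := BL.
  have [x _] := nB _ BL.
  have [|y []] := Bpin (~` closure (range (fun _ : L => x))); first by exists (fun=> x).
  by rewrite B0.
have [|y [By]] := Bpin (~` closure (range g)); first by exists g.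
by rewrite -Bg; apply; exact: subset_closure.
Qed.

End pinning_down.

(** The cardinals of dense sets have a least element, so d(X) is attained by a dense set, which is
    no larger than [D]. *)
Lemma dense_density_le (L : Type) (X : topologicalType) (D : set X) :
  dense D -> D #<= [set: L] -> density_le X L.
Proof.
move=> dD DL.
have [E Emin] := card_le_min
  (fun E : {E : set X | dense E} => set_type (sval E)) (exist _ D dD).
have {}Emin (A : set X) : dense A -> sval E #<= A.
  move=> dA; have := Emin (exist _ A dA).
  by rewrite (card_le_eql (card_setT _)) (card_le_eqr (card_setT _)).
exists (set_type (sval E)); last first.
  by rewrite (card_le_eql (card_setT _)); apply: card_le_trans DL; exact: Emin.
split; first by exists (sval E); [exact: (svalP E) | exact: card_setT_sym].
by move=> A dA; rewrite (card_le_eql (card_setT _)); exact: Emin.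
Qed.

Theorem corollary2p9 (L : Type) (X : topologicalType) :
  infinite_set [set: L] ->
  hausdorff_space X ->
  pinning_down_pair (set (set L)) L X ->
  density_le X L.
Proof.
move=> Linf X2 pinX; have [D dD DL] := pinning_down_dense Linf pinX X2.
exact: dense_density_le dD DL.
Qed.
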